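(* Let $G(\mathcal V,\mathcal E)$ be a directed graph on $n$ agents, let $\mathcal F\subseteq\mathcal V$, $|\mathcal F|\le f<n$, be the set of agents that crash in an execution of Algorithm 6, $\mathcal N=\mathcal V-\mathcal F$, and suppose every reduced graph of $G$ under crash faults contains a source component. Let $\phi_i=|N_i^-\cap\mathcal F|$ for $i\in\mathcal V$, $$\tilde\beta=\min\Big\{\frac1{\max_{i\in\mathcal V}(d_i^-+1-\phi_i)},\ \frac1{|\mathcal N|}\Big\},\qquad\tilde\gamma=\min_{i\in\mathcal V}(d_i^-+1-\phi_i).$$ Then Algorithm 6 optimizes a function in $\widetilde{\mathcal A}(\tilde\beta,\tilde\gamma)$; that is, $$\lim_{t\to\infty}|x_i[t]-x_j[t]|=0\ \text{ for all } i,j\in\mathcal N,\qquad \lim_{t\to\infty}\mathrm{Dist}\big(x_i[t],\widetilde Y(\tilde\beta,\tilde\gamma)\big)=0\ \text{ for all } i\in\mathcal N.$$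
   Context: **System.** A synchronous system of $n$ agents $\mathcal V=\{1,\dots,n\}$ communicates over a directed graph $G(\mathcal V,\mathcal E)$ without self-loops; $N_i^-=\{j:(j,i)\in\mathcal E\}$, $d_i^-=|N_i^-|$. The agents of $\mathcal F$ crash at some point of the execution. $\mathcal N[t]$ is the set of agents that have not crashed by the beginning of iteration $t\ge1$, $\bar{\mathcal N}[t]=\mathcal N[t+1]$ the set of those that have not crashed by the end of iteration $t$. **Local functions.** $\mathcal X\subseteq\mathbb R$ is a nonempty closed convex set and $L$ is a fixed constant. Each agent $i$ has an admissible function $h_i:\mathcal X\to\mathbb R$: convex, continuously differentiable, $h_i'$ is $L$-Lipschitz, $|h_i'(x)|\le L$ on $\mathcal X$, and $\arg\min_{x\in\mathcal X}h_i(x)$ is nonempty and compact. $P_{\mathcal X}$ is the projection onto $\mathcal X$; $\mathrm{Dist}(x,S)=\inf_{y\in S}|x-y|$. **Reduced graphs.** A reduced graph under crash faults is obtained from $G$ by removing all edges incident to the nodes of some $F\subseteq\mathcal F$. Its source component is the collection of nodes of $\mathcal V-F$ each of which has a directed path, in the subgraph induced by $\mathcal V-F$, to every other node of $\mathcal V-F$ (it exists if this collection is nonempty). **Valid functions.** $\widetilde{\mathcal A}(\beta,\gamma)$ is the set of functions $p=\sum_{i\in\mathcal V}\alpha_ih_i$ with $\alpha_i\ge0$, $\sum_{i\in\mathcal V}\alpha_i=1$ and $|\{i\in\mathcal N:\alpha_i\ge\beta\}|\ge\gamma$; $\widetilde Y(\beta,\gamma)=\bigcup_{p\in\widetilde{\mathcal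 A}(\beta,\gamma)}\arg\min_{x\in\mathcal X}p(x)$. **Stepsizes.** $\lambda[t]>0$, $\lambda[t+1]\le\lambda[t]$ for $t\ge 0$, $\sum_t\lambda[t]=\infty$, $\sum_t\lambda^2[t]<\infty$. **Algorithm 6.** Each agent $j$ has an initial state $x_j[0]\in\mathcal X$. In iteration $t\ge1$ each agent $j\in\mathcal N[t]$ sends the pair $(x_j[t-1],h_j'(x_j[t-1]))$ on all outgoing edges, receives such pairs from a set $\mathcal R_j(t)$ of agents with $N_j^-\cap\bar{\mathcal N}[t]\subseteq\mathcal R_j(t)\subseteq N_j^-\cap\mathcal N[t]$ (an agent crashing during iteration $t$ may reach only some of its out-neighbours), lets $\ell_j(t)=|\mathcal R_j(t)|$, and (if it does not crash) updates $$x_j[t]=P_{\mathcal X}\Big[\tfrac1{\ell_j(t)+1}\sum_{i\in\mathcal R_j(t)\cup\{j\}}\big(x_i[t-1]-\lambda[t-1]\,h_i'(x_i[t-1])\big)\Big].$$ *)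

(* Defs.v *)
From HB Require Import structures.
From mathcomp Require Import all_boot all_order all_algebra.
From mathcomp Require Import all_classical all_reals all_analysis.

Set Implicit Arguments.
Unset Strict Implicit.
Unset Printing Implicit Defensive.

Import Order.TTheory GRing.Theory Num.Theory.
Import numFieldNormedType.Exports.

Local Open Scope classical_set_scope.
Local Open Scope ring_scope.

(* Functions on X are represented by total functions R -> R; every notion below
   only looks at their values on X. *)
Section LocalFunctions.
Context {R : realType}.
Implicit Types (X S : set R) (h dh : R -> R).

Definition argmin X h : set R :=
  [set x | X x /\ forall y, X y -> h x <= h y].

(* The derivative is taken along X, hence one-sided at an endpoint of X.  If X
   is a single point the limit is vacuous and dh is arbitrary there. *)
Definition derivative_on X h dh : Prop :=
  forall x, X x -> (h y - h x) / (y - x) @[y --> within X x^'] --> dh x.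

Record admissible X (L : R) h dh : Prop := Admissible {
  admissible_convex : convex_function (E := R^o) X h;
  admissible_derivative : derivative_on X h dh;
  admissible_continuous : {within X, continuous dh};
  admissible_lipschitz : L.-lipschitz_X (dh : R^o -> R^o);
  admissible_bound : forall x, X x -> `|dh x| <= L;
  admissible_argmin_neq0 : argmin X h !=set0;
  admissible_argmin_compact : compact (argmin X h)
}.

(* The nearest point exists and is unique for X nonempty, closed and convex. *)
Definition project X (y : R) : R :=
  get [set z | X z /\ forall w, X w -> `|y - z| <= `|y - w|].

(* Extended-real valued, so that the distance to the empty set is +oo, not 0. *)
Definition Dist (x : R) S : \bar R :=
  ereal_inf [set (`|x - y|)%:E | y in S].

End LocalFunctions.

(* E j i means that (j, i) is an edge. *)
Section Graph.
Context {n : nat}.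
Implicit Types (E : rel 'I_n) (F : {set 'I_n}) (i j : 'I_n).

Definition in_nbrs E i : {set 'I_n} := finset (fun j => E j i).

Definition reduced E F : rel 'I_n :=
  fun i j => [&& i \notin F, j \notin F & E i j].

Definition source_component E F : {set 'I_n} :=
  finset (fun i => (i \notin F) &&
    [forall j, (j \notin F) ==> connect (reduced E F) i j]).

(* d_i^- + 1 - phi_i; the truncated subtraction is exact as phi_i <= d_i^-. *)
Definition live_deg E F i : nat :=
  (#|in_nbrs E i| + 1 - #|in_nbrs E i :&: F|)%N.

Definition beta_tilde (R : realType) E F : R :=
  Num.min ((\max_(i < n) live_deg E F i)%:R^-1) (#|~: F|%:R^-1).

(* Without self-loops d_i^- + 1 <= n, so starting the iterated minimum from n
   does not change its value (for n > 0). *)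
Definition gamma_tilde E F : nat :=
  \big[minn/n]_(i < n) live_deg E F i.

End Graph.

Section ValidFunctions.
Context {R : realType} {n : nat}.
Implicit Types (X : set R) (N : {set 'I_n}) (h : 'I_n -> R -> R)
  (beta : R) (gamma : nat).

Definition valid_functions N h beta gamma : set (R -> R) :=
  [set p | exists alpha : 'I_n -> R,
    [/\ forall i, 0 <= alpha i,
        \sum_i alpha i = 1,
        (gamma <= #|[set i in N | (beta <= alpha i)%R]%SET|)%N &
        p = (fun x => \sum_i alpha i * h i x)]].

Definition valid_optima X N h beta gamma : set R :=
  \bigcup_(p in valid_functions N h beta gamma) argmin X p.

End ValidFunctions.

Record stepsizes {R : realType} (lam : nat -> R) : Prop := Stepsizes {
  stepsizes_gt0 : forall t, 0 < lam t;
  stepsizes_noninc : forall t, lam t.+1 <= lam t;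
  stepsizes_sum : (\sum_(0 <= t <oo) (lam t)%:E = +oo)%E;
  stepsizes_sum_sqr : (\sum_(0 <= t <oo) (lam t ^+ 2)%:E < +oo)%E
}.

(* [alive t], for t >= 1, is the set of agents that have not crashed by the
   beginning of iteration t, so that [alive t.+1] is the set of those that have
   not crashed by its end; [alive 0] plays no role.  The crash times are
   arbitrary: [alive 1] may already be smaller than the whole set. *)
Definition crash_pattern {n : nat} (F : {set 'I_n})
    (alive : nat -> {set 'I_n}) : Prop :=
  (forall t, (1 <= t)%N -> alive t.+1 \subset alive t) /\
  (forall i, i \in F <-> exists2 t, (1 <= t)%N & i \notin alive t).

(* Iterations t >= 1 are written t.+1.  [rcv t j] is the set of agents from
   which j receives a message in iteration t.  The states [x j t] of an agent j
   that has crashed by the end of iteration t >= 1 are unconstrained. *)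
Record execution {R : realType} {n : nat} (X : set R) (E : rel 'I_n)
    (dh : 'I_n -> R -> R) (lam : nat -> R) (alive : nat -> {set 'I_n})
    (rcv : nat -> 'I_n -> {set 'I_n}) (x : 'I_n -> nat -> R) : Prop :=
  Execution {
  execution_init : forall j, X (x j 0%N);
  execution_rcv : forall t j, j \in alive t.+1 ->
    (in_nbrs E j :&: alive t.+2 \subset rcv t.+1 j) &&
    (rcv t.+1 j \subset in_nbrs E j :&: alive t.+1);
  execution_update : forall t j, j \in alive t.+2 ->
    x j t.+1 = project X ((#|rcv t.+1 j| + 1)%:R^-1 *
      \sum_(i in rcv t.+1 j :|: [set j]%SET)
        (x i t - lam t * dh i (x i t)))
}.

(* Main.v *)
(* Once all of F has crashed, the live agents run projected subgradient descent
   with one fixed row-stochastic matrix W.  The root of the reduced graph for F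
   makes the powers of W contract the spread D of the states, and square
   summability of the stepsizes gives sum D^2 < oo.  For a stationary
   distribution pi of W the function sum_j pi_j (x_j - z)^2 is quasi-Fejer for
   every minimiser z of p = sum_i pi_i h_i, so all states converge to one
   minimiser a of p.

   In general pi is not a vector of valid weights.  But pi_i <= 1/gamma, so the
   slope sum_i pi_i h_i'(a) lies between slopes attained by valid weights, and
   connectedness of the set of valid weights yields a valid alpha with
   sum_i alpha_i h_i'(a) = sum_i pi_i h_i'(a).  By convexity a also minimises
   sum_i alpha_i h_i. *)

Require Import Defs.
From mathcomp Require Import all_boot all_order all_algebra.
From mathcomp Require Import all_classical all_reals all_analysis.
From mathcomp Require Import ring lra.

Set Implicit Arguments.
Unset Strict Implicit.
Unset Printing Implicit Defensive.

Import Order.TTheory GRing.Theory Num.Theory.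
Import numFieldNormedType.Exports.

Local Open Scope classical_set_scope.
Local Open Scope ring_scope.

(** * Convexity and projection on the line *)

Section ConvexOnLine.
Context {R : realType}.
Implicit Types (X : set R) (f df : R -> R).

Lemma convex_setP X a b s :
  convex_set (M := R^o) X -> X a -> X b -> 0 <= s <= 1 -> X (s * a + (1 - s) * b).
Proof.
move=> cX Xa Xb /andP[s0 s1].
by have /set_mem := cX a b (Itv01 s0 s1) (mem_set Xa) (mem_set Xb).
Qed.

Lemma convex_set_between X a b z :
  convex_set (M := R^o) X -> X a -> X b -> a <= z <= b -> X z.
Proof.
move=> cX Xa Xb /andP[az zb].
have [ab|ba] := ltP a b; last first.
  by have -> : z = a by apply/eqP; rewrite eq_le az (le_trans zb).
have ba0 : 0 < b - a by rewrite subr_gt0.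
have t0 : 0 <= (b - z) / (b - a) by rewrite divr_ge0 ?subr_ge0 // ltW.
have t1 : (b - z) / (b - a) <= 1 by rewrite ler_pdivrMr // mul1r lerD2l lerN2.
rewrite (_ : z = (b - z) / (b - a) * a + (1 - (b - z) / (b - a)) * b).
  by apply: convex_setP => //; rewrite t0.
by field; rewrite lt0r_neq0.
Qed.

Lemma convex_functionP X f a b s :
  convex_function (E := R^o) X f -> X a -> X b -> 0 <= s <= 1 ->
  f (s * a + (1 - s) * b) <= s * f a + (1 - s) * f b.
Proof.
move=> cf Xa Xb /andP[s0 s1].
have := cf (Itv01 s0 s1) a b (mem_set Xa) (mem_set Xb).
by rewrite !convRE.
Qed.

(** Convexity bounds the difference quotient at [z = s * y + (1 - s) * x], scaled by [y - x], by
    [f y - f x]. For small [s] the quotient is within [e / |y - x|] of [df x], which costs only [e]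
    after scaling. No case split on the sign of [y - x] arises. *)
Lemma convex_gradient X f df x y :
  convex_set (M := R^o) X -> convex_function (E := R^o) X f ->
  derivative_on X f df -> X x -> X y ->
  f x + df x * (y - x) <= f y.
Proof.
move=> cX cf dfP Xx Xy.
have [->|yx] := eqVneq y x; first by rewrite subrr mulr0 addr0.
apply/ler_addgt0Pr => e e0.
have d0 : 0 < `|y - x| by rewrite normr_gt0 subr_eq0.
have e0' : 0 < e / `|y - x| by rewrite divr_gt0.
have /cvgrPdist_lt /(_ _ e0') := dfP x Xx.
move=> /nbhs_ballP[r /= r0 rP].
pose s := Num.min 1 (r / (2 * `|y - x|)).
have s0 : 0 < s by rewrite lt_min ltr01 divr_gt0 // mulr_gt0.
have s1 : s <= 1 by rewrite ge_min lexx.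
have sr : s * `|y - x| < r.
  apply: (@le_lt_trans _ _ (r / 2)).
    rewrite -ler_pdivlMr // -mulrA -invfM ge_min.
    by rewrite lexx orbT.
  lra.
pose z := s * y + (1 - s) * x.
have zx : z - x = s * (y - x) by rewrite /z; ring.
have Xz : X z by apply: convex_setP => //; rewrite (ltW s0).
have := rP z.
rewrite /ball /= distrC zx normrM gtr0_norm // => /(_ sr) /(_ _ Xz).
have zx0 : z != x by rewrite -subr_eq0 zx mulf_neq0 ?subr_eq0 ?yx ?lt0r_neq0.
move=> /(_ zx0); rewrite ltr_pdivlMr // => /ltW.
have fz : f z <= s * f y + (1 - s) * f x.
  by apply: (convex_functionP cf Xy Xx); rewrite (ltW s0).
rewrite -normrM => /ler_normlW.
rewrite mulrBl [_ / _ * _](_ : _ = (f z - f x) / s); last first.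
  by field; rewrite subr_eq0 yx lt0r_neq0.
have : (f z - f x) / s <= f y - f x.
  rewrite ler_pdivrMr //; lra.
lra.
Qed.

End ConvexOnLine.

Section Projection.
Context {R : realType} (X : set R).
Hypotheses (X0 : X !=set0) (cX : closed X).

(** It suffices to minimise over the compact part of [X] within distance [|y - a|] of [y]: any point
    further away loses to [a]. *)
Lemma projectP y :
  X (project X y) /\ forall w, X w -> `|y - project X y| <= `|y - w|.
Proof.
suff [z zP] : exists z, X z /\ forall w, X w -> `|y - z| <= `|y - w|.
  exact: (@getPex R [set z | X z /\ forall w, X w -> `|y - z| <= `|y - w|]
    (ex_intro _ z zP)).
have [a Xa] := X0.
pose K := X `&` `[y - `|y - a|, y + `|y - a|]%classic.
have [|||c /set_mem[Xc _] cP] := @compact_EVT_min R R (fun z => `|y - z|) K.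
- by exists a; split => //=; rewrite in_itv /= -ler_distlC lexx.
- rewrite /K setIC; apply: compact_closedI => //.
  exact: segment_compact.
- apply: continuous_subspaceT => z.
  apply: cvg_norm; apply: cvgB; [exact: cvg_cst|exact: cvg_id].
exists c; split => // w Xw.
have [wa|/ltW aw] := leP `|y - w| `|y - a|.
  by apply: cP; apply/mem_set; split => //=; rewrite in_itv /= -ler_distlC.
apply: le_trans aw; apply: cP; apply/mem_set; split => //=.
by rewrite in_itv /= -ler_distlC lexx.
Qed.

Lemma project_in y : X (project X y).
Proof. by case: (projectP y). Qed.

Hypothesis cvX : convex_set (M := R^o) X.

(** If [y] lay between [w] and its projection [z], convexity would put [y] in [X] and force [z = y].
    Otherwise [w] and [z] are on the same side of [y], and [z], being nearest, lies between [y] and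
    [w]. *)
Lemma project_contract y w : X w -> `|project X y - w| <= `|y - w|.
Proof.
move=> Xw; have [Xz zP] := projectP y; set z := project X y in Xz zP *.
have zw := zP w Xw.
have [yz|yz] := eqVneq y z; first by rewrite yz.
have [ltyz|] := ltP y z.
  have [wy|yw] := leP w y.
    have /zP : X y by apply: (convex_set_between cvX Xw Xz); rewrite wy ltW.
    by rewrite subrr normr0 normr_le0 subr_eq0 (negbTE yz).
  rewrite (ltr0_norm (_ : y - w < 0)) ?subr_lt0 // in zw *.
  rewrite ltr0_norm ?subr_lt0 // in zw.
  rewrite ler0_norm ?subr_le0; lra.
rewrite le_eqVlt eq_sym (negbTE yz) /= => ltzy.
have [yw|wy] := leP y w.
  have /zP : X y by apply: (convex_set_between cvX Xz Xw); rewrite yw ltW.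
  by rewrite subrr normr0 normr_le0 subr_eq0 (negbTE yz).
rewrite (gtr0_norm (_ : 0 < y - w)) ?subr_gt0 // in zw *.
rewrite gtr0_norm ?subr_gt0 // in zw.
rewrite ger0_norm ?subr_ge0; lra.
Qed.

End Projection.

(** * Perturbed averaging *)

Section Averaging.
Context {R : realType}.

(** Summing the recursion bounds a partial sum [S] by its first [K] terms plus [q * S + C]; as
    [q < 1] this can be solved for [S]. *)
Lemma contraction_sum_bounded (a b : nat -> R) (K : nat) (q C : R) :
  (forall t, 0 <= a t) -> q < 1 ->
  (forall t, a (K + t)%N <= q * a t + b t) ->
  (forall m, \sum_(t < m) b t <= C) ->
  exists B, forall m, \sum_(t < m) a t <= B.
Proof.
move=> a0 q1 aP bC; exists ((\sum_(t < K) a t + C) / (1 - q)) => m.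
rewrite ler_pdivlMr ?subr_gt0 //.
have : \sum_(t < m) a t <= \sum_(t < K) a t + (q * \sum_(t < m) a t + C).
  apply: (@le_trans _ _ (\sum_(t < (K + m)%N) a t)).
    by rewrite addnC big_split_ord /= lerDl sumr_ge0.
  rewrite big_split_ord /= lerD2l (le_trans _ (lerD (lexx _) (bC m))) //.
  by rewrite mulr_sumr -big_split ler_sum.
lra.
Qed.

Variables (n : nat) (W : 'I_n -> 'I_n -> R).
Hypotheses (W_ge0 : forall j i, 0 <= W j i) (W_sum : forall j, \sum_i W j i = 1).

Lemma average_le (y : 'I_n -> R) j M :
  (forall i, y i <= M) -> \sum_i W j i * y i <= M.
Proof.
move=> yM; rewrite -[leRHS]mul1r -(W_sum j) mulr_suml.
by apply: ler_sum => i _; rewrite ler_wpM2l.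
Qed.

Lemma average_ge (y : 'I_n -> R) j M :
  (forall i, M <= y i) -> M <= \sum_i W j i * y i.
Proof.
move=> yM; rewrite -[leLHS]mul1r -(W_sum j) mulr_suml.
by apply: ler_sum => i _; rewrite ler_wpM2l.
Qed.

(** The two sides differ by the variance of [y] about its mean [m]. *)
Lemma average_sqr (y : 'I_n -> R) j c :
  (\sum_i W j i * y i - c) ^+ 2 <= \sum_i W j i * (y i - c) ^+ 2.
Proof.
set m := \sum_i W j i * y i.
have : 0 <= \sum_i W j i * (y i - m) ^+ 2.
  by apply: sumr_ge0 => i _; rewrite mulr_ge0 // sqr_ge0.
rewrite [X in _ <= X -> _](_ : _ = \sum_i W j i * (y i - c) ^+ 2
    - 2 * (m - c) * (\sum_i W j i * y i) + (m ^+ 2 - c ^+ 2) * (\sum_i W j i)).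
  rewrite W_sum -/m; lra.
rewrite !mulr_sumr -sumrB -big_split /=; apply: eq_bigr => i _; ring.
Qed.

(** [W] fixes the constant vector, so [W - 1] is singular and some nonzero row vector [v] satisfies
    [v W = v]. Its entries may have mixed signs, but [|v|] turns out to be invariant too and only
    needs normalising. *)
Lemma stationary_distribution : (0 < n)%N ->
  exists pi : 'I_n -> R, [/\ forall i, 0 <= pi i, \sum_i pi i = 1 &
    forall i, \sum_j pi j * W j i = pi i].
Proof.
move=> n0; pose A : 'M[R]_n := \matrix_(j, i) W j i.
have : \det (A - 1%:M) == 0.
  rewrite -det_tr; apply/det0P; exists (const_mx 1).
    apply/eqP => /matrixP/(_ 0 (Ordinal n0)).
    by rewrite !mxE => /eqP; rewrite oner_eq0.
  rewrite linearB /= trmx1 mulmxBr mulmx1; apply/eqP; rewrite subr_eq0.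
  apply/eqP/matrixP => k j; rewrite !mxE -[RHS](W_sum j).
  by apply: eq_bigr => i _; rewrite !mxE mul1r.
move=> /det0P[v v0 /eqP]; rewrite mulmxBr mulmx1 subr_eq0 => /eqP vA.
have vE i : v 0 i = \sum_j v 0 j * W j i.
  by rewrite -{1}vA mxE; apply: eq_bigr => j _; rewrite mxE.
pose s := \sum_i `|v 0 i|.
have s0 : 0 < s.
  rewrite lt_def sumr_ge0 // andbT; apply: contra_neq v0 => /eqP.
  rewrite psumr_eq0 // => /allP sv; apply/matrixP => k i.
  rewrite ord1 mxE; apply/eqP; rewrite -normr_eq0.
  by have := sv i; rewrite mem_index_enum => /(_ isT).
(* |v| <= |v| W entrywise, and both sides have the same total mass. *)
have le_abs i : `|v 0 i| <= \sum_j `|v 0 j| * W j i.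
  rewrite {1}vE; apply: le_trans (ler_norm_sum _ _ _) _.
  by apply: ler_sum => j _; rewrite normrM (ger0_norm (W_ge0 _ _)).
have eq_mass : \sum_i (\sum_j `|v 0 j| * W j i - `|v 0 i|) = 0.
  rewrite sumrB exchange_big /= -[X in _ - X]/s; apply/eqP; rewrite subr_eq0.
  by apply/eqP/eq_bigr => j _; rewrite -mulr_sumr W_sum mulr1.
have eq_abs i : \sum_j `|v 0 j| * W j i = `|v 0 i|.
  move/eqP: eq_mass; rewrite psumr_eq0 => [/allP/(_ i)|k _]; last first.
    by rewrite subr_ge0.
  by rewrite mem_index_enum subr_eq0 => /(_ isT)/eqP.
exists (fun i => `|v 0 i| / s); split => [i||i].
- by rewrite divr_ge0 // ltW.
- by rewrite -mulr_suml divff // lt0r_neq0.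
- by rewrite -[in RHS]eq_abs mulr_suml; apply: eq_bigr => j _; rewrite mulrAC.
Qed.

Variable r : 'I_n.
Hypotheses (W_rr : 0 < W r r)
  (W_root : forall j, connect (fun i j => 0 < W j i) r j).

Lemma weight_lower_bound :
  exists w, [/\ 0 < w, w <= 1 & forall j i, 0 < W j i -> w <= W j i].
Proof.
(* The seed 1 gives [w <= 1], used later for [w ^+ n <= 1]. *)
pose w := \big[Num.min/1]_(p : 'I_n * 'I_n | 0 < W p.1 p.2) W p.1 p.2.
exists w; split.
- by apply: lt_bigmin.
- exact: bigmin_le_id.
- by move=> j i Wji; apply: (bigmin_le_cond _ (j := (j, i))).
Qed.

(** * Contraction along paths from the root *)

Section Contraction.
Variables (w : R) (e : nat -> R).
Hypotheses (w_gt0 : 0 < w)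
  (w_le : forall j i, 0 < W j i -> w <= W j i)
  (e_noninc : forall t, e t.+1 <= e t).

Lemma noninc_addn (t k : nat) : e (t + k)%N <= e t.
Proof. by elim: k => [|k IH]; rewrite ?addn0 // addnS (le_trans (e_noninc _)). Qed.

Lemma perturbed_average_le (x : 'I_n -> nat -> R) t M k :
  (forall j t, x j t.+1 <= \sum_i W j i * x i t + e t) ->
  (forall i, x i t <= M) -> forall i, x i (t + k)%N <= M + k%:R * e t.
Proof.
move=> xP xM; elim: k => [|k IH] i; first by rewrite addn0 mul0r addr0.
rewrite addnS (le_trans (xP _ _)) // -natr1 mulrDl mul1r addrA lerD //.
  exact: average_le.
exact: noninc_addn.
Qed.

(** The gap [M - x r t] propagates along a path from [r], keeping at least a fraction [w] per edge,
    while each step adds at most [e t]. The hypothesis is one-sided so that the lemma also applies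
    to the negated states. *)
Lemma perturbed_average_contract (x : 'I_n -> nat -> R) t M :
  (forall j t, x j t.+1 <= \sum_i W j i * x i t + e t) ->
  (forall i, x i t <= M) ->
  forall j, x j (t + n)%N <= M - w ^+ n * (M - x r t) + n%:R * e t.
Proof.
move=> xP xM j.
(* A duplicate-free path has fewer than [n] edges. Allowing [size p <= k] instead of equality lets
   all agents be treated at the common time [t + n]. *)
suff along k p : path (fun i j => 0 < W j i) r p -> (size p <= k)%N ->
    x (last r p) (t + k)%N <= M - w ^+ k * (M - x r t) + k%:R * e t.
  have /connectP[p rp ->] := W_root j.
  case/shortenP: rp => p' rp' /card_uniqP /= pU _; apply: along => //.
  have := max_card [in r :: p']; rewrite pU card_ord; exact: ltnW.
elim: k p => [|k IH] p rp.
  by rewrite leqn0 size_eq0 => /eqP-> /=; rewrite addn0 expr0; lra.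
move=> pk.
(* [i0] is the predecessor on the path, or [r] itself when the path is empty: the positive weight
   [W r r] lets the gap wait at the root. *)
have [i0 Wi0 xi0] : exists2 i0, 0 < W (last r p) i0 &
    x i0 (t + k)%N <= M - w ^+ k * (M - x r t) + k%:R * e t.
  case/lastP: p rp pk => [_ _|p i].
    by exists r => //; apply: (IH [::]).
  rewrite rcons_path last_rcons size_rcons ltnS => /andP[rp Wi] pk.
  by exists (last r p) => //; apply: IH.
rewrite addnS (le_trans (xP _ _)) // -natr1 mulrDl mul1r addrA.
rewrite lerD ?noninc_addn //.
set d := w ^+ k * (M - x r t) in xi0.
have d0 : 0 <= d by rewrite mulr_ge0 ?exprn_ge0 ?subr_ge0 // ltW.
have wd : w * d <= W (last r p) i0 * d by rewrite ler_wpM2r // w_le.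
have : \sum_i W (last r p) i * x i (t + k)%N <=
    \sum_i (W (last r p) i * (M + k%:R * e t) - (i == i0)%:R * (W (last r p) i * d)).
  apply: ler_sum => i _; have Wi : 0 <= W (last r p) i by [].
  case: eqP => [->|_]; last first.
    rewrite mul0r subr0 ler_wpM2l //; exact: perturbed_average_le.
  rewrite mul1r -mulrBr ler_wpM2l //; lra.
have pick_i0 : \sum_i (i == i0)%:R * (W (last r p) i * d) = W (last r p) i0 * d.
  rewrite (bigD1 i0) //= eqxx mul1r big1 ?addr0 // => i /negbTE ->.
  by rewrite mul0r.
rewrite sumrB -mulr_suml W_sum mul1r pick_i0.
rewrite exprS -mulrA -/d; lra.
Qed.

End Contraction.

(** [D] is the maximum minus the minimum of the states. Contracting both [x] and [-x] and adding,
    the value at [r] cancels and the spread shrinks by the factor [1 - eta] over [n] steps, up to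
    [2 * n * e t]. *)
Lemma spread_sqr_summable (x : 'I_n -> nat -> R) (e : nat -> R) C :
  (forall t, 0 <= e t) -> (forall t, e t.+1 <= e t) ->
  (forall m, \sum_(t < m) e t ^+ 2 <= C) ->
  (forall j t, `|x j t.+1 - \sum_i W j i * x i t| <= e t) ->
  exists D : nat -> R, (forall i j t, `|x i t - x j t| <= D t) /\
    exists B, forall m, \sum_(t < m) D t ^+ 2 <= B.
Proof.
move=> e0 eni eC xe; have [w [w0 w1 wW]] := weight_lower_bound.
pose u t := \big[Num.max/x r t]_i x i t.
pose l t := \big[Num.min/x r t]_i x i t.
have xu i t : x i t <= u t by exact: le_bigmax.
have lx i t : l t <= x i t by exact: bigmin_le.
have uP t M : (forall i, x i t <= M) -> u t <= M.
  by move=> xM; apply: bigmax_le => // i _.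
have lP t M : (forall i, M <= x i t) -> M <= l t.
  by move=> xM; apply: le_bigmin => // i _.
have D0 t : 0 <= u t - l t by rewrite subr_ge0 (le_trans (lx r t)).
exists (fun t => u t - l t); split => [i j t|].
  have := xu i t; have := lx i t; have := xu j t; have := lx j t.
  by rewrite ler_norml; lra.
pose eta := w ^+ n.
have eta0 : 0 < eta by rewrite exprn_gt0.
have eta1 : eta <= 1 by rewrite exprn_ile1 // ltW.
have step t : u (n + t)%N - l (n + t)%N <=
    (1 - eta) * (u t - l t) + 2 * n%:R * e t.
  have up : u (n + t)%N <= u t - eta * (u t - x r t) + n%:R * e t.
    apply: uP => j; rewrite addnC; apply: perturbed_average_contract => // i s.
    by rewrite -lerBlDl (le_trans (ler_norm _)).
  have low : - l (n + t)%N <= - l t - eta * (- l t - - x r t) + n%:R * e t.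
    rewrite lerNl; apply: lP => j; rewrite addnC lerNl.
    apply: (@perturbed_average_contract w e _ _ _ (fun i s => - x i s)) => //.
      move=> i s; rewrite -lerBlDl (le_trans (ler_norm _)) //.
      rewrite -normrN (le_trans _ (xe i s)) // le_eqVlt; apply/orP; left.
      apply/eqP; congr `|_|; rewrite opprD opprK opprK; congr (_ + _).
      by rewrite -sumrN; apply: eq_bigr => k _; rewrite mulrN.
    by move=> i; rewrite lerN2.
  lra.
apply: (@contraction_sum_bounded (fun t => (u t - l t) ^+ 2)
  (fun t => (2 * n%:R * e t) ^+ 2 / eta) n (1 - eta)
  ((2 * n%:R) ^+ 2 / eta * C)).
- by move=> t; exact: sqr_ge0.
- by rewrite gtrBl.
- move=> t; set d := u t - l t; set s := 2 * n%:R * e t.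
  have s0 : 0 <= s by rewrite !mulr_ge0.
  apply: (@le_trans _ _ (((1 - eta) * d + s) ^+ 2)).
    rewrite ler_sqr ?nnegrE //.
    apply: addr_ge0 => //; apply: mulr_ge0; [by rewrite subr_ge0|exact: D0].
  (* Convexity of the square for the mixture [(1 - eta) * d + eta * (s / eta)], with its defect
     written out. *)
  rewrite -subr_ge0 (_ : _ - _ = eta * (1 - eta) * (d - s / eta) ^+ 2).
    apply: mulr_ge0 (sqr_ge0 _); apply: mulr_ge0; first exact: ltW.
    by rewrite subr_ge0.
  by field; rewrite lt0r_neq0.
- move=> m; apply: le_trans (ler_wpM2l _ (eC m)); last first.
    by rewrite divr_ge0 ?sqr_ge0 // ltW.
  rewrite mulr_sumr; apply: ler_sum => t _; rewrite exprMn le_eqVlt; apply/orP.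
  by left; apply/eqP; ring.
Qed.

End Averaging.

(** * Sums of convex functions *)

Section RealSeries.
Context {R : realType}.
Implicit Types (u V b : nat -> R).

Lemma bounded_series_cvg u B :
  (forall t, 0 <= u t) -> (forall m, \sum_(t < m) u t <= B) -> cvgn (series u).
Proof.
move=> u0 uB; apply: nondecreasing_is_cvgn.
  by apply/nondecreasing_seqP => m; rewrite /series /= big_nat_recr //= lerDl.
by exists B => _ [m _ <-]; rewrite /series /= big_mkord.
Qed.

(** Subtracting the partial sums of [b] from [V] leaves a nonincreasing sequence bounded below by
    [- B]. *)
Lemma quasi_fejer_cvg V b B :
  (forall t, 0 <= V t) -> (forall t, 0 <= b t) ->
  (forall m, \sum_(t < m) b t <= B) ->
  (forall t, V t.+1 <= V t + b t) -> cvgn V.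
Proof.
move=> V0 b0 bB Vb; have cb := bounded_series_cvg b0 bB.
have -> : V = (V - series b) + series b by rewrite subrK.
apply: is_cvgD => //; apply: nonincreasing_is_cvgn.
  apply/nonincreasing_seqP => m; rewrite !fctE /series /= big_nat_recr //=.
  have := Vb m; lra.
exists (- B) => _ [m _ <-]; rewrite !fctE /series /= big_mkord.
have := V0 m; have := bB m; lra.
Qed.

End RealSeries.

Section ConvexSum.
Context {R : realType} (X : set R) (L : R) (n : nat) (h dh : 'I_n -> R -> R)
  (pi : 'I_n -> R).
Hypotheses (X_convex : convex_set (M := R^o) X)
  (h_grad : forall i y z, X y -> X z -> h i y + dh i y * (z - y) <= h i z)
  (dh_bound : forall i y, X y -> `|dh i y| <= L)
  (pi_ge0 : forall i, 0 <= pi i) (pi_sum : \sum_i pi i = 1).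

Let p y := \sum_i pi i * h i y.

Lemma local_lipschitz i y z : X y -> X z -> h i y - h i z <= L * `|y - z|.
Proof.
move=> Xy Xz; apply: (@le_trans _ _ (`|dh i y| * `|y - z|)).
  rewrite -normrM (le_trans _ (ler_norm _)) //.
  have := h_grad i Xy Xz; lra.
by rewrite ler_wpM2r // dh_bound.
Qed.

Lemma sum_lipschitz y z : X y -> X z -> p y - p z <= L * `|y - z|.
Proof.
move=> Xy Xz; rewrite -sumrB -[leRHS]mul1r -pi_sum mulr_suml.
apply: ler_sum => i _; rewrite -mulrBr ler_wpM2l //.
exact: local_lipschitz.
Qed.

Lemma sum_gradient y z : X y -> X z ->
  p y + (\sum_i pi i * dh i y) * (z - y) <= p z.
Proof.
move=> Xy Xz; rewrite mulr_suml -big_split /=; apply: ler_sum => i _.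
by rewrite -mulrA -mulrDr ler_wpM2l // h_grad.
Qed.

(* Left of every chosen minimiser all the h i are nonincreasing, right of all
   of them all are nondecreasing, so p can be minimised over the segment
   spanned by the minimisers. *)
Lemma sum_argmin_neq0 : (0 < n)%N -> (forall i, argmin X (h i) !=set0) ->
  argmin X p !=set0.
Proof.
move=> n0 hmin; have /choice[m mP] := hmin.
pose i0 := Ordinal n0.
have [l lm] : exists l, forall i, m l <= m i.
  by case: (@arg_minP _ _ _ i0 xpredT m isT) => l _ lP; exists l => i; exact: lP.
have [u um] : exists u, forall i, m i <= m u.
  by case: (@arg_maxP _ _ _ i0 xpredT m isT) => u _ uP; exists u => i; exact: uP.
have Xm i : X (m i) by case: (mP i).
have between z : m l <= z <= m u -> X z by exact: convex_set_between.
have down i y : X y -> y <= m l -> h i (m l) <= h i y.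
  move=> Xy yl; have [Xi /(_ _ (Xm l)) hi] := mP i.
  have := lm i; rewrite le_eqVlt => /orP[/eqP->|li].
    by have [_] := mP i; apply.
  have g1 := h_grad i (Xm l) Xi; have g2 := h_grad i (Xm l) Xy.
  have : dh i (m l) * (m i - m l) <= 0 by lra.
  rewrite pmulr_lle0 ?subr_gt0 // => d0.
  have : 0 <= dh i (m l) * (y - m l) by rewrite mulr_le0 // subr_le0.
  lra.
have up i y : X y -> m u <= y -> h i (m u) <= h i y.
  move=> Xy uy; have [Xi /(_ _ (Xm u)) hi] := mP i.
  have := um i; rewrite le_eqVlt => /orP[/eqP<-|iu].
    by have [_] := mP i; apply.
  have g1 := h_grad i (Xm u) Xi; have g2 := h_grad i (Xm u) Xy.
  have : dh i (m u) * (m i - m u) <= 0 by lra.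
  rewrite nmulr_lle0 ?subr_lt0 // => d0.
  have : 0 <= dh i (m u) * (y - m u) by rewrite mulr_ge0 // subr_ge0.
  lra.
have [|c cP cmin] := EVT_min (f := p) (lm u).
  apply/subspace_continuousP => y /=; rewrite in_itv /= => /between Xy.
  (* [L] may be 0, so [L + 1] serves as the divisor in the continuity modulus. *)
  have L1 : 0 < L + 1 by rewrite ltr_wpDl // (le_trans _ (dh_bound i0 Xy)).
  apply/cvgrPdist_le => e e0; apply/nbhs_ballP; exists (e / (L + 1)) => /=.
    exact: divr_gt0.
  move=> z; rewrite /ball /= ltr_pdivlMr // => yz zI.
  have Xz : X z by apply: between; rewrite in_itv in zI.
  have le_e : L * `|y - z| <= e by have := normr_ge0 (y - z); lra.
  rewrite ler_norml lerNl opprB (le_trans (sum_lipschitz Xz Xy)) 1?distrC //.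
  exact: le_trans (sum_lipschitz Xy Xz) _.
have cX : X c by apply: between; rewrite in_itv in cP.
exists c; split => // y Xy.
have [ly|yl] := leP (m l) y; last first.
  apply: (@le_trans _ _ (p (m l))).
    by apply: cmin; rewrite in_itv /= lexx lm.
  by apply: ler_sum => i _; rewrite ler_wpM2l // down // ltW.
have [yu|uy] := leP y (m u).
  by apply: cmin; rewrite in_itv /= ly.
apply: (@le_trans _ _ (p (m u))).
  by apply: cmin; rewrite in_itv /= lexx um.
by apply: ler_sum => i _; rewrite ler_wpM2l // up // ltW.
Qed.

End ConvexSum.

(** * Convergence of projected averaging descent *)

Section Dynamics.
Context {R : realType} (X : set R) (L : R) (n : nat) (h dh : 'I_n -> R -> R)
  (W : 'I_n -> 'I_n -> R) (pi : 'I_n -> R) (r : 'I_n) (lam : nat -> R)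
  (x : 'I_n -> nat -> R) (C : R).
Hypotheses (X0 : X !=set0) (X_closed : closed X)
  (X_convex : convex_set (M := R^o) X)
  (h_grad : forall i y z, X y -> X z -> h i y + dh i y * (z - y) <= h i z)
  (dh_bound : forall i y, X y -> `|dh i y| <= L)
  (h_argmin : forall i, argmin X (h i) !=set0)
  (W_ge0 : forall j i, 0 <= W j i) (W_sum : forall j, \sum_i W j i = 1)
  (W_rr : 0 < W r r)
  (W_root : forall j, connect (fun i j => 0 < W j i) r j)
  (pi_ge0 : forall i, 0 <= pi i) (pi_sum : \sum_i pi i = 1)
  (pi_stationary : forall i, \sum_j pi j * W j i = pi i)
  (lam_gt0 : forall t, 0 < lam t) (lam_noninc : forall t, lam t.+1 <= lam t)
  (lam_div : forall B, exists m, B < \sum_(t < m) lam t)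
  (lam_sqr : forall m, \sum_(t < m) lam t ^+ 2 <= C)
  (x_in : forall j t, X (x j t))
  (x_step : forall j t, x j t.+1 =
     project X (\sum_i W j i * (x i t - lam t * dh i (x i t)))).

Let p y := \sum_i pi i * h i y.
Let V z t := \sum_j pi j * (x j t - z) ^+ 2.

Lemma bound_ge0 : 0 <= L.
Proof. exact: le_trans (normr_ge0 _) (dh_bound r (x_in r 0)). Qed.

Lemma average_in j t : X (\sum_i W j i * x i t).
Proof.
case: (@arg_minP _ _ _ r xpredT (x^~ t) isT) => l _ lP.
case: (@arg_maxP _ _ _ r xpredT (x^~ t) isT) => u _ uP.
apply: (convex_set_between X_convex (x_in l t) (x_in u t)).
apply/andP; split.
  by apply: average_ge => // i; exact: lP.
by apply: average_le => // i; exact: uP.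
Qed.

(** The unperturbed average lies in [X], so projecting does not increase the distance to it, and
    that distance is an average of gradient steps. *)
Lemma step_near_average j t :
  `|x j t.+1 - \sum_i W j i * x i t| <= L * lam t.
Proof.
rewrite x_step (le_trans (project_contract X0 X_closed X_convex _ (average_in j t))) //.
rewrite -sumrB (le_trans (ler_norm_sum _ _ _)) //.
rewrite -[leRHS]mul1r -(W_sum j) mulr_suml; apply: ler_sum => i _.
rewrite mulrBr addrAC subrr add0r normrN !normrM.
rewrite (ger0_norm (W_ge0 _ _)) (gtr0_norm (lam_gt0 t)) ler_wpM2l //.
by rewrite mulrC ler_wpM2r ?dh_bound // ltW.
Qed.

Lemma consensus : exists D : nat -> R, (forall i j t, `|x i t - x j t| <= D t) /\
  exists B, forall m, \sum_(t < m) D t ^+ 2 <= B.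
Proof.
apply: (@spread_sqr_summable _ _ W W_ge0 W_sum r W_rr W_root x (fun t => L * lam t)
  (L ^+ 2 * C)) => [t|t|m|j t].
- by rewrite mulr_ge0 ?bound_ge0 // ltW.
- by rewrite ler_wpM2l ?bound_ge0.
- rewrite (le_trans _ (ler_wpM2l (sqr_ge0 L) (lam_sqr m))) // mulr_sumr.
  by apply: ler_sum => t _; rewrite exprMn.
- exact: step_near_average.
Qed.

(** * Lyapunov analysis of the weighted squared distance to a minimiser *)

Section Lyapunov.
Variables (D : nat -> R) (B : R).
Hypotheses (D_ge : forall i j t, `|x i t - x j t| <= D t)
  (D_sqr : forall m, \sum_(t < m) D t ^+ 2 <= B).

(** The term [L ^+ 2 * lam t ^+ 2] bounds the squared gradient step; the rest bounds the cross term
    [2 * lam t * (L * D t)] by a sum of squares, which makes the error summable. *)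
Let b t := (L ^+ 2 + L) * lam t ^+ 2 + L * D t ^+ 2.

Lemma error_ge0 t : 0 <= b t.
Proof.
have L0 := bound_ge0; apply: addr_ge0; apply: mulr_ge0; rewrite ?sqr_ge0 //.
exact: addr_ge0 (sqr_ge0 _) L0.
Qed.

Lemma error_sum m : \sum_(t < m) b t <= (L ^+ 2 + L) * C + L * B.
Proof.
rewrite big_split /= -!mulr_sumr; apply: lerD.
  exact: ler_wpM2l (addr_ge0 (sqr_ge0 _) bound_ge0) _ _ (lam_sqr m).
exact: ler_wpM2l bound_ge0 _ _ (D_sqr m).
Qed.

Lemma lyapunov_ge0 z t : 0 <= V z t.
Proof. by apply: sumr_ge0 => j _; rewrite mulr_ge0 ?sqr_ge0. Qed.

(* Stationarity of pi absorbs the averaging step; the spread D only enters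
   through evaluating every h i at the state of r. *)
Lemma lyapunov_step z t : X z ->
  V z t.+1 + 2 * lam t * (p (x r t) - p z) <= V z t + b t.
Proof.
move=> Xz.
pose y i := x i t - lam t * dh i (x i t).
have V1 : V z t.+1 <= \sum_i pi i * (y i - z) ^+ 2.
  under [leRHS]eq_bigr do rewrite -pi_stationary mulr_suml.
  rewrite exchange_big; apply: ler_sum => j _ /=.
  under eq_bigr do rewrite -mulrA.
  rewrite -mulr_sumr ler_wpM2l // (le_trans _ (average_sqr _ _ _ _ _)) //.
  rewrite x_step -ler_sqrt ?sqr_ge0 // !sqrtr_sqr.
  exact: project_contract.
have yi i : pi i * (y i - z) ^+ 2 <= pi i * (x i t - z) ^+ 2
    - 2 * lam t * (pi i * h i (x r t) - pi i * h i z) + pi i * b t.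
  suff /(ler_wpM2l (pi_ge0 i)) : (y i - z) ^+ 2 <=
      (x i t - z) ^+ 2 - 2 * lam t * (h i (x r t) - h i z) + b t by lra.
  have g := h_grad i (x_in i t) Xz.
  have l := local_lipschitz h_grad dh_bound i (x_in r t) (x_in i t).
  have {}l : h i (x r t) - h i (x i t) <= L * D t.
    by rewrite (le_trans l) // ler_wpM2l ?bound_ge0.
  have g2 : dh i (x i t) ^+ 2 <= L ^+ 2.
    by rewrite -real_normK ?num_real // ler_sqr ?nnegrE ?bound_ge0 // dh_bound.
  (* The gradient inequality holds at [x i t]; moving the function value to the common point [x r t]
     costs [L * D t]. *)
  have a1 : 2 * lam t * (h i (x r t) - h i z - L * D t) <=
      2 * lam t * (dh i (x i t) * (x i t - z)).
    rewrite ler_wpM2l ?mulr_ge0 ?(ltW (lam_gt0 t)) //; lra.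
  have a2 : lam t ^+ 2 * dh i (x i t) ^+ 2 <= lam t ^+ 2 * L ^+ 2.
    by rewrite ler_wpM2l ?sqr_ge0.
  have a3 : 0 <= L * (lam t - D t) ^+ 2 by rewrite mulr_ge0 ?sqr_ge0 ?bound_ge0.
  rewrite /y /b; lra.
have : \sum_i pi i * (y i - z) ^+ 2 <= V z t - 2 * lam t * (p (x r t) - p z) + b t.
  apply: le_trans (ler_sum _ (fun i _ => yi i)) _.
  by rewrite big_split sumrB /= -mulr_sumr sumrB -mulr_suml pi_sum mul1r.
lra.
Qed.

(** As [pi i] may vanish, [V] alone does not control agent [i]. Each [x j t] is within [D t] of
    [x i t], and the resulting bounds are averaged over [j] with weights [pi j]. *)
Lemma state_le_lyapunov i z t : (x i t - z) ^+ 2 <= 2 * V z t + 2 * D t ^+ 2.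
Proof.
have avg c : c = \sum_j pi j * c by rewrite -mulr_suml pi_sum mul1r.
rewrite [leLHS]avg [2 * D t ^+ 2]avg mulr_sumr -big_split /=.
apply: ler_sum => j _; rewrite [X in _ <= X + _]mulrCA -mulrDr ler_wpM2l //.
have : (x i t - x j t) ^+ 2 <= D t ^+ 2.
  rewrite -real_normK ?num_real // ler_sqr ?nnegrE //.
  exact: le_trans (D_ge i j t).
have := sqr_ge0 (x i t - x j t - (x j t - z)); lra.
Qed.

Lemma lyapunov_le_state z t : V z t <= 2 * (x r t - z) ^+ 2 + 2 * D t ^+ 2.
Proof.
have avg c : c = \sum_j pi j * c by rewrite -mulr_suml pi_sum mul1r.
rewrite [leRHS]avg; apply: ler_sum => j _; rewrite ler_wpM2l //.
have : (x j t - x r t) ^+ 2 <= D t ^+ 2.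
  rewrite -real_normK ?num_real // ler_sqr ?nnegrE //.
  exact: le_trans (D_ge j r t).
have := sqr_ge0 (x j t - x r t - (x r t - z)); lra.
Qed.

Lemma spread_sqr_cvg0 : D t ^+ 2 @[t --> \oo] --> (0 : R).
Proof. by apply/cvg_series_cvg_0/(bounded_series_cvg _ D_sqr) => t; exact: sqr_ge0. Qed.

Lemma lyapunov_cvg z : argmin X p z -> cvgn (V z).
Proof.
move=> [Xz zmin].
apply: (@quasi_fejer_cvg _ (V z) b ((L ^+ 2 + L) * C + L * B)).
- exact: lyapunov_ge0.
- exact: error_ge0.
- exact: error_sum.
move=> t; apply: le_trans (lyapunov_step t Xz).
by rewrite lerDl !mulr_ge0 ?subr_ge0 ?(ltW (lam_gt0 t)) // zmin.
Qed.

Lemma lyapunov_sum z m : X z ->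
  V z m + \sum_(t < m) 2 * lam t * (p (x r t) - p z) <=
  V z 0 + ((L ^+ 2 + L) * C + L * B).
Proof.
move=> Xz; apply: le_trans (lerD (lexx _) (error_sum m)).
elim: m => [|m IH]; first by rewrite !big_ord0.
rewrite !big_ord_recr /=; have := lyapunov_step m Xz; lra.
Qed.

(** If the optimality gap stayed at least [e] from time [k] on, [lyapunov_sum] would bound the
    divergent sum of stepsizes. *)
Lemma near_optimal_infinitely_often z e k : argmin X p z -> 0 < e ->
  exists2 t, (k <= t)%N & p (x r t) < p z + e.
Proof.
move=> [Xz zmin] e0; apply: contrapT => no.
have far t : (k <= t)%N -> e <= p (x r t) - p z.
  move=> kt; rewrite lerBrDl leNgt; apply/negP => lt; apply: no; exists t => //.
pose K := V z 0 + ((L ^+ 2 + L) * C + L * B).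
(* Adding the first [k] stepsizes to the threshold makes those from index [k] on exceed
   [K / (2 * e)] by themselves. *)
have [m mP] := lam_div (K / (2 * e) + \sum_(t < k) lam t).
have := lyapunov_sum (k + m) Xz.
rewrite leNgt => /negP; apply.
rewrite -/K (lt_le_trans (_ : _ < 2 * e * \sum_(t < m) lam (k + t)%N)) //.
  rewrite mulrC -ltr_pdivrMr ?mulr_gt0 // -(ltrD2r (\sum_(t < k) lam t)).
  apply: lt_le_trans mP _; rewrite addrC.
  have : \sum_(t < m) lam t <= \sum_(t < (k + m)%N) lam t.
    by rewrite addnC big_split_ord /= lerDl sumr_ge0 // => t _; exact: ltW.
  by rewrite big_split_ord.
rewrite big_split_ord /= ler_wpDl ?lyapunov_ge0 // ler_wpDl //.
  by apply: sumr_ge0 => t _; rewrite !mulr_ge0 ?subr_ge0 ?(ltW (lam_gt0 _)) // zmin.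
rewrite mulr_sumr; apply: ler_sum => t _.
have := far (k + t)%N (leq_addr _ _) => ft.
have := lam_gt0 (k + t)%N => l0.
rewrite -mulrA [e * _]mulrC mulrA ler_wpM2l ?mulr_ge0 ?(ltW l0) //.
Qed.

Lemma states_bounded z : argmin X p z ->
  exists M, forall t, `|x r t - z| <= M.
Proof.
move=> [Xz zmin].
pose K := 2 * (V z 0 + ((L ^+ 2 + L) * C + L * B)) + 2 * B.
exists (Num.sqrt K) => t; rewrite -sqrtr_sqr ler_wsqrtr //.
apply: le_trans (state_le_lyapunov r z t) _; rewrite lerD // ler_wpM2l //.
  apply: le_trans (lyapunov_sum t Xz); rewrite lerDl.
  by apply: sumr_ge0 => s _; rewrite !mulr_ge0 ?subr_ge0 ?(ltW (lam_gt0 _)) // zmin.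
rewrite (le_trans _ (D_sqr t.+1)) // big_ord_recr /= lerDr sumr_ge0 // => s _.
exact: sqr_ge0.
Qed.

(** [V a] converges because [a] is a minimiser, and it is arbitrarily small at late times when [x r]
    is near [a]. So its limit is 0, which draws every state to [a]. *)
Lemma states_cvg_of_cluster a : argmin X p a ->
  (forall e k, 0 < e -> exists2 t, (k <= t)%N & `|x r t - a| < e) ->
  forall i, x i t @[t --> \oo] --> a.
Proof.
move=> amin ain; have /cvg_ex[/= v Vv] := lyapunov_cvg amin.
have v0 : v <= 0.
  apply/ler_addgt0Pr => e e0; rewrite add0r.
  (* Five shares: one for the limit of [V], two each for the squared distance of [x r] from [a] and
     for [D ^+ 2] in [lyapunov_le_state]. *)
  have e5 : 0 < e / 5 by rewrite divr_gt0.
  have /cvgrPdist_lt /(_ _ e5) [k1 _ k1P] := Vv.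
  have /cvgrPdist_lt /(_ _ e5) [k2 _ k2P] := spread_sqr_cvg0.
  have s0 : 0 < Num.sqrt (e / 5) by rewrite sqrtr_gt0.
  have [t tk ta] := ain _ (maxn k1 k2) s0.
  have /= := k1P t (leq_trans (leq_maxl _ _) tk); rewrite ltr_norml => /andP[_ vt].
  have /= := k2P t (leq_trans (leq_maxr _ _) tk).
  rewrite sub0r normrN ger0_norm ?sqr_ge0 // => dt.
  have {}ta : (x r t - a) ^+ 2 < e / 5.
    by rewrite -real_normK ?num_real // -(sqr_sqrtr (ltW e5)) ltr_sqr ?nnegrE.
  have := lyapunov_le_state a t; lra.
have V0 : V a t @[t --> \oo] --> (0 : R).
  suff <- : v = 0 by [].
  apply/eqP; rewrite eq_le v0 /=; apply: (cvgr_to_ge Vv).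
  by apply: nearW => t; exact: lyapunov_ge0.
move=> i; apply/cvgrPdist_lt => e e0.
have e4 : 0 < e ^+ 2 / 4 by rewrite divr_gt0 ?exprn_gt0.
have /cvgrPdist_lt /(_ _ e4) [k1 _ k1P] := V0.
have /cvgrPdist_lt /(_ _ e4) [k2 _ k2P] := spread_sqr_cvg0.
exists (maxn k1 k2) => // t /= tk.
have /= := k1P t (leq_trans (leq_maxl _ _) tk).
rewrite sub0r normrN ger0_norm ?lyapunov_ge0 // => vt.
have /= := k2P t (leq_trans (leq_maxr _ _) tk).
rewrite sub0r normrN ger0_norm ?sqr_ge0 // => dt.
rewrite distrC -ltr_sqr ?nnegrE ?(ltW e0) // real_normK ?num_real //.
have := state_le_lyapunov i a t; lra.
Qed.

(** Times [tau k >= k] with optimality gap below [1 / (k + 1)] give a bounded sequence in [X]; by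
    Lipschitz continuity of [p] any cluster point is optimal. *)
Lemma optimal_cluster z : argmin X p z ->
  exists2 a, argmin X p a &
    forall e k, 0 < e -> exists2 t, (k <= t)%N & `|x r t - a| < e.
Proof.
move=> zmin; have [M MP] := states_bounded zmin.
have e0 k : 0 < k.+1%:R^-1 :> R by rewrite invr_gt0.
have /choice[tau tauP] : forall k, exists t, (k <= t)%N /\ p (x r t) < p z + k.+1%:R^-1.
  by move=> k; have [t kt pt] := near_optimal_infinitely_often k zmin (e0 k); exists t.
pose K := `[z - M, z + M]%classic `&` X.
have cK : compact K by apply: compact_closedI => //; exact: segment_compact.
have [|a [[_ Xa] ca]] := cK (x r (tau k) @[k --> \oo]) _.
  exists 0%N => // k _; split => //=.
  by rewrite in_itv /= -ler_distlC distrC.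
have near_a e k : 0 < e -> exists2 j, (k <= j)%N & `|x r (tau j) - a| < e.
  move=> e_gt0.
  have [_ [[j /= kj <-] aj]] := ca [set x r (tau j) | j in [set j | (k <= j)%N]]
    (ball a e)
    (ex_intro2 _ _ k I (fun j kj => ex_intro2 _ _ j kj erefl)) (nbhsx_ballx _ _ e_gt0).
  by exists j => //; rewrite distrC.
exists a; last first.
  move=> e k e_gt0; have [j kj ja] := near_a e k e_gt0.
  by exists (tau j) => //; exact: leq_trans kj (tauP j).1.
have [Xz zP] := zmin.
suff az : p a <= p z by split => // y Xy; exact: le_trans az (zP y Xy).
apply/ler_addgt0Pr => e e_gt0.
(* [L * d] pays for passing from [x r (tau j)] to [a], the remaining [2 * d] for the optimality gap
   there. *)
have [d d0 dE] : exists2 d, 0 < d & L * d + 2 * d = e.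
  have L2 : 0 < L + 2 by rewrite ltr_wpDl ?bound_ge0.
  exists (e / (L + 2)); first exact: divr_gt0.
  by field; rewrite lt0r_neq0.
have [k _ /(_ k (leqnn k)) /= kP] := near_infty_natSinv_lt (PosNum d0).
have [j kj ja] := near_a _ k d0.
have [_ pj] := tauP j.
have l : p a - p (x r (tau j)) <= L * `|a - x r (tau j)|.
  exact: (sum_lipschitz h_grad dh_bound pi_ge0 pi_sum).
have {}pj : p (x r (tau j)) < p z + d.
  apply: lt_trans pj _; rewrite ltrD2l; apply: le_lt_trans kP.
  by rewrite lef_pV2 ?posrE // ler_nat.
have Ld : L * `|a - x r (tau j)| <= L * d.
  by rewrite ler_wpM2l ?bound_ge0 // distrC ltW.
lra.
Qed.

End Lyapunov.

Lemma states_cvg_argmin :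
  exists2 a, argmin X p a & forall i, x i t @[t --> \oo] --> a.
Proof.
have [D [D_ge [B D_sqr]]] := consensus.
have [z zmin] := sum_argmin_neq0 X_convex h_grad dh_bound pi_ge0 pi_sum
  (leq_ltn_trans (leq0n r) (ltn_ord r)) h_argmin.
have [a amin ain] := optimal_cluster D_ge D_sqr zmin.
by exists a => // i; exact: (states_cvg_of_cluster D_ge D_sqr amin ain).
Qed.

End Dynamics.

(** * Valid weights *)

Section Weights.
Context {R : realType} {n : nat}.
Implicit Types (N T : {set 'I_n}) (g pi : 'I_n -> R) (k : nat).

(** Weights capped at [1 / k] do best when all mass sits uniformly on [k] agents with the largest
    [g]. An exchange argument shows that a [k]-subset with maximal sum consists of such agents. *)
Lemma top_subset N k g pi :
  (0 < k)%N -> (k <= #|N|)%N ->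
  (forall i, 0 <= pi i) -> (forall i, i \notin N -> pi i = 0) ->
  \sum_i pi i = 1 -> (forall i, pi i <= k%:R^-1) ->
  exists T : {set 'I_n}, [/\ T \subset N, #|T| = k &
    \sum_i pi i * g i <= k%:R^-1 * \sum_(i in T) g i].
Proof.
move=> k0 kN pi0 piN pi1 pik.
pose P (T : {set 'I_n}) := (T \subset N) && (#|T| == k).
have [T0 PT0] : exists T0, P T0.
  have : (0 < #|[set A : {set 'I_n} | (A \subset N) && (#|A| == k)]%SET|)%N.
    by rewrite cards_draws bin_gt0.
  by move=> /card_gt0P[T0]; rewrite inE => ?; exists T0.
case: (@arg_maxP _ _ _ T0 P (fun T => \sum_(i in T) g i) PT0).
move=> T /andP[TN /eqP Tk] Tmax.
exists T; split=> //.
have exchange a b : a \in T -> b \in N -> b \notin T -> g b <= g a.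
  move=> aT bN bT.
  have bTa : b \notin T :\ a by rewrite !inE (negbTE bT) andbF.
  have := Tmax (b |: (T :\ a))%SET.
  rewrite big_setU1 //= [X in _ <= X](big_setD1 a) //=.
  rewrite lerD2r; apply; apply/andP; split.
    by rewrite finset.subUset finset.sub1set bN (fintype.subset_trans _ TN) //
      finset.subsetDl.
  by rewrite cardsU1 bTa -Tk (cardsD1 a T) aT.
have [a0 a0T] : exists a0, a0 \in T by apply/card_gt0P; rewrite Tk.
case: (@arg_minP _ _ _ a0 (mem T) g a0T) => a aT amin.
have kR : 0 < k%:R :> R by rewrite ltr0n.
(* Subtracting the threshold [g a], the least value on [T], shifts both means equally and makes the
   comparison termwise: [g i - g a] is nonnegative on [T] and nonpositive on the rest of [N]. *)
have le i : pi i * (g i - g a) <= (i \in T)%:R * (k%:R^-1 * (g i - g a)).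
  case: (boolP (i \in T)) => iT.
    by rewrite mul1r ler_wpM2r // subr_ge0; exact: amin.
  rewrite mul0r; case: (boolP (i \in N)) => iN; last by rewrite piN // mul0r.
  by rewrite mulr_ge0_le0 // subr_le0 exchange.
have : \sum_i pi i * (g i - g a) <= k%:R^-1 * \sum_(i in T) (g i - g a).
  rewrite mulr_sumr [leRHS]big_mkcond /=.
  apply: le_trans (ler_sum _ (fun i _ => le i)) _.
  by apply: ler_sum => i _; case: ifP; rewrite ?mul1r ?mul0r.
under eq_bigr do rewrite mulrBr.
rewrite sumrB -mulr_suml pi1 mul1r sumrB sumr_const Tk mulrBr -[g a *+ k]mulr_natl.
by rewrite mulrA mulVf ?mul1r ?lerD2r // lt0r_neq0.
Qed.

Lemma segment_weight (u v c : R) : u <= c <= v ->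
  exists s, [/\ 0 <= s, s <= 1 & (1 - s) * u + s * v = c].
Proof.
move=> /andP[uc cv]; have [uv|vu] := ltP u v; last first.
  by exists 0; split=> //; lra.
have uv0 : 0 < v - u by rewrite subr_gt0.
exists ((c - u) / (v - u)); split.
- by rewrite divr_ge0 ?subr_ge0 // ltW.
- by rewrite ler_pdivrMr // mul1r lerD2r.
- by field; rewrite lt0r_neq0.
Qed.

(* Every weight vector that is at least 1 / #|N| on some k-subset T can be
   moved along a segment to the uniform weights on N without leaving that class;
   the mean of g along such a segment takes all intermediate values. *)
Lemma valid_weights_above N k g pi :
  (0 < k)%N -> (k <= #|N|)%N ->
  (forall i, 0 <= pi i) -> (forall i, i \notin N -> pi i = 0) ->
  \sum_i pi i = 1 -> (forall i, pi i <= k%:R^-1) ->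
  #|N|%:R^-1 * \sum_(i in N) g i <= \sum_i pi i * g i ->
  exists alpha : 'I_n -> R, [/\ forall i, 0 <= alpha i, \sum_i alpha i = 1,
    (k <= #|[set i in N | (#|N|%:R^-1 <= alpha i)%R]%SET|)%N &
    \sum_i alpha i * g i = \sum_i pi i * g i].
Proof.
move=> k0 kN pi0 piN pi1 pik low.
have [T [TN Tk high]] := top_subset g k0 kN pi0 piN pi1 pik.
have [s [s0 s1 sE]] := segment_weight (introT andP (conj low high)).
have kR : 0 < k%:R :> R by rewrite ltr0n.
have NR : 0 < #|N|%:R :> R by rewrite ltr0n (leq_trans k0).
(* On [T] both uniform weights are at least [1 / #|N|], hence so is any mixture of them. *)
pose alpha i := (1 - s) * (#|N|%:R^-1 * (i \in N)%:R) + s * (k%:R^-1 * (i \in T)%:R).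
have mean (f : 'I_n -> R) : \sum_i alpha i * f i =
    (1 - s) * (#|N|%:R^-1 * \sum_(i in N) f i) + s * (k%:R^-1 * \sum_(i in T) f i).
  rewrite !mulr_sumr [X in _ = X + _]big_mkcond [X in _ = _ + X]big_mkcond.
  rewrite -big_split /=; apply: eq_bigr => i _.
  by rewrite /alpha; case: (i \in N); case: (i \in T) => /=; ring.
have s1' : 0 <= 1 - s by rewrite subr_ge0.
exists alpha; split.
- move=> i; apply: addr_ge0; apply: mulr_ge0 => //; apply: mulr_ge0 => //.
- have := mean (fun=> 1); under eq_bigr do rewrite mulr1.
  move=> ->; rewrite !sumr_const Tk !mulVf ?lt0r_neq0 //; ring.
- rewrite -Tk; apply: subset_leq_card; apply/fintype.subsetP => i iT.
  have iN := fintype.subsetP TN i iT.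
  rewrite inE iN /= /alpha iT iN !mulr1.
  have : #|N|%:R^-1 <= k%:R^-1 :> R by rewrite lef_pV2 ?posrE // ler_nat.
  by move=> /(ler_wpM2l s0); lra.
- by rewrite mean.
Qed.

(** When the mean under [pi] is below the uniform mean on [N], the previous case is applied to
    [- g]. *)
Lemma valid_weights N k g pi :
  (0 < k)%N -> (k <= #|N|)%N ->
  (forall i, 0 <= pi i) -> (forall i, i \notin N -> pi i = 0) ->
  \sum_i pi i = 1 -> (forall i, pi i <= k%:R^-1) ->
  exists alpha : 'I_n -> R, [/\ forall i, 0 <= alpha i, \sum_i alpha i = 1,
    (k <= #|[set i in N | (#|N|%:R^-1 <= alpha i)%R]%SET|)%N &
    \sum_i alpha i * g i = \sum_i pi i * g i].
Proof.
move=> k0 kN pi0 piN pi1 pik.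
have [low|/ltW high] := leP (#|N|%:R^-1 * \sum_(i in N) g i) (\sum_i pi i * g i).
  exact: valid_weights_above.
have oppE (f : 'I_n -> R) : \sum_i f i * - g i = - \sum_i f i * g i.
  by rewrite -sumrN; apply: eq_bigr => i _; rewrite mulrN.
have [|alpha [a0 a1 ak]] := @valid_weights_above N k (fun i => - g i) pi
    k0 kN pi0 piN pi1 pik.
  by rewrite oppE sumrN mulrN lerN2.
by rewrite !oppE => /oppr_inj aE; exists alpha.
Qed.

End Weights.

(** * First-order optimality conditions *)

Section FirstOrder.
Context {R : realType} (X : set R) (L : R) (n : nat) (h dh : 'I_n -> R -> R).
Hypotheses (X_convex : convex_set (M := R^o) X)
  (h_grad : forall i y z, X y -> X z -> h i y + dh i y * (z - y) <= h i z)
  (dh_lip : forall i y z, X y -> X z -> `|dh i y - dh i z| <= L * `|y - z|).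
Implicit Types (pi alpha : 'I_n -> R).

(** At a point [z] slightly towards [y], minimality of [a] and the gradient inequality give the
    slope [H] at [z] the right sign; the Lipschitz bound on the [dh i] carries this over to the
    slope [G] at [a]. *)
Lemma argmin_slope pi a y :
  (forall i, 0 <= pi i) -> \sum_i pi i = 1 ->
  argmin X (fun y => \sum_i pi i * h i y) a -> X y ->
  0 <= (\sum_i pi i * dh i a) * (y - a).
Proof.
move=> pi0 pi1 [Xa amin] Xy; set G := \sum_i _.
have [->|ya] := eqVneq y a; first by rewrite subrr mulr0.
have d0 : 0 < `|y - a| by rewrite normr_gt0 subr_eq0.
rewrite -oppr_le0; apply/ler_addgt0Pr => e e0; rewrite add0r.
(* The error [|H - G| * |y - a|] is at most [s * K]; the summand 1 keeps [K] positive. *)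
pose K := `|L| * `|y - a| ^+ 2 + 1.
have K0 : 0 < K by rewrite ltr_wpDl // mulr_ge0 ?sqr_ge0.
pose s := Num.min 1 (e / K).
have s0 : 0 < s by rewrite lt_min ltr01 divr_gt0.
have s1 : s <= 1 by rewrite ge_min lexx.
have sK : s * K <= e by rewrite -ler_pdivlMr // ge_min lexx orbT.
pose z := s * y + (1 - s) * a.
have Xz : X z by apply: convex_setP => //; rewrite (ltW s0).
have za : z - a = s * (y - a) by rewrite /z; ring.
pose H := \sum_i pi i * dh i z.
have Hs : 0 <= H * (y - a).
  have := sum_gradient h_grad pi0 Xz Xa; have := amin z Xz.
  rewrite -/H (_ : a - z = - (s * (y - a))); last by rewrite -za opprB.
  move=> a1 a2; have : 0 <= s * (H * (y - a)) by lra.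
  by rewrite pmulr_rge0.
have HG : `|H - G| <= `|L| * (s * `|y - a|).
  rewrite -sumrB (le_trans (ler_norm_sum _ _ _)) // -[leRHS]mul1r -pi1 mulr_suml.
  apply: ler_sum => i _; rewrite -mulrBr normrM (ger0_norm (pi0 i)) ler_wpM2l //.
  apply: le_trans (dh_lip i Xz Xa) _.
  by rewrite za normrM (gtr0_norm s0) ler_wpM2r ?ler_norm // mulr_ge0 // ltW.
have : (H - G) * (y - a) <= `|L| * (s * `|y - a|) * `|y - a|.
  by rewrite (le_trans (ler_norm _)) // normrM ler_wpM2r.
rewrite /K in sK; lra.
Qed.

(** The first-order condition sees the weights only through the slope at [a], and by convexity it is
    sufficient for optimality. *)
Lemma argmin_same_slope pi alpha a :
  (forall i, 0 <= pi i) -> \sum_i pi i = 1 -> (forall i, 0 <= alpha i) ->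
  \sum_i alpha i * dh i a = \sum_i pi i * dh i a ->
  argmin X (fun y => \sum_i pi i * h i y) a ->
  argmin X (fun y => \sum_i alpha i * h i y) a.
Proof.
move=> pi0 pi1 a0 aE amin; have [Xa _] := amin; split => // y Xy.
have := argmin_slope pi0 pi1 amin Xy; rewrite -aE.
have := sum_gradient h_grad a0 Xa Xy; lra.
Qed.

End FirstOrder.

(** * Crash executions *)

Section Stepsizes.
Context {R : realType} (lam : nat -> R).
Hypothesis lamP : stepsizes lam.

Lemma stepsizes_tail_sum T B : exists m, B < \sum_(t < m) lam (T + t)%N.
Proof.
suff [m mP] : exists m, B + \sum_(t < T) lam t < \sum_(t < m) lam t.
  exists m; rewrite -(ltrD2l (\sum_(t < T) lam t)) addrC (lt_le_trans mP) //.
  have : \sum_(t < m) lam t <= \sum_(t < (T + m)%N) lam t.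
    rewrite addnC big_split_ord /= lerDl sumr_ge0 // => t _.
    exact/ltW/stepsizes_gt0.
  by rewrite big_split_ord.
apply: contrapT => no; have := stepsizes_sum lamP; apply/eqP.
rewrite lt_eqF // (@le_lt_trans _ _ (B + \sum_(t < T) lam t)%:E) ?ltry //.
apply: lime_le.
  by apply: is_cvg_nneseries => t _ _; rewrite lee_fin ltW // stepsizes_gt0.
apply: nearW => m; rewrite sumEFin lee_fin big_mkord leNgt.
by apply/negP => mP; apply: no; exists m.
Qed.

Lemma stepsizes_tail_sum_sqr T :
  exists C, forall m, \sum_(t < m) lam (T + t)%N ^+ 2 <= C.
Proof.
have sq0 t : (0 <= (lam t ^+ 2)%:E)%E by rewrite lee_fin sqr_ge0.
pose S := (\sum_(0 <= t <oo) (lam t ^+ 2)%:E)%E.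
have S_fin : S \is a fin_num.
  by rewrite ge0_fin_numE ?(stepsizes_sum_sqr lamP) // nneseries_ge0.
exists (fine S) => m.
apply: (@le_trans _ _ (\sum_(t < (T + m)%N) lam t ^+ 2)).
  by rewrite big_split_ord /= lerDr sumr_ge0 // => t _; exact: sqr_ge0.
rewrite -lee_fin fineK // -sumEFin -(big_mkord predT (fun t => (lam t ^+ 2)%:E)).
by apply: nneseries_lim_ge => t _ _; exact: sq0.
Qed.

End Stepsizes.

Section Network.
Context {n : nat} (E : rel 'I_n) (F : {set 'I_n}).

(** Once all of [F] has crashed, a live [j] averages over exactly these agents. *)
Definition closed_live_nbrs j : {set 'I_n} := j |: (in_nbrs E j :&: ~: F).

Lemma live_degE j : irreflexive E -> live_deg E F j = #|closed_live_nbrs j|.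
Proof.
move=> E_irr; rewrite /live_deg /closed_live_nbrs cardsU1 !inE E_irr add1n.
have <- := cardsID F (in_nbrs E j).
by rewrite finset.setDE -addnA addKn addn1.
Qed.

Lemma closed_live_nbrs_sub j : j \notin F -> closed_live_nbrs j \subset ~: F.
Proof.
by move=> jF; rewrite finset.subUset finset.sub1set inE jF finset.subsetIr.
Qed.

Lemma gamma_tilde_le j : (gamma_tilde E F <= live_deg E F j)%N.
Proof.
rewrite /gamma_tilde; have := mem_index_enum j.
elim: (index_enum _) => // k s IH; rewrite big_cons inE => /orP[/eqP->|/IH].
  exact: geq_minl.
by apply: leq_trans; exact: geq_minr.
Qed.

Lemma gamma_tilde_gt0 : (0 < n)%N -> (0 < gamma_tilde E F)%N.
Proof.
move=> n0; rewrite /gamma_tilde; elim/big_ind: _ => // [a b a0 b0|i _].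
  by rewrite leq_min a0.
by rewrite /live_deg subn_gt0 addn1 ltnS subset_leq_card // finset.subsetIl.
Qed.

(** There are finitely many agents, so a latest crash time exists; beyond it the decreasing sets
    [alive] have shed all of [F]. *)
Lemma crash_pattern_stable alive : crash_pattern F alive ->
  (forall t j, j \notin F -> j \in alive t.+1) /\
  exists T, forall t, alive (T + t).+1 = ~: F.
Proof.
move=> [mono crash].
have live t j : j \notin F -> j \in alive t.+1.
  by move=> jF; apply: contraNT jF => jt; apply/crash; exists t.+1.
split=> //.
have /choice[tau tauP] : forall j, exists t, j \in F -> (1 <= t)%N /\ j \notin alive t.
  move=> j; case: (boolP (j \in F)) => [/crash[t t1 jt]|_]; last by exists 0%N.
  by exists t.
have sub t s : (1 <= t)%N -> alive (t + s)%N \subset alive t.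
  move=> t1; elim: s => [|s IH]; first by rewrite addn0.
  by rewrite addnS (fintype.subset_trans _ IH) // mono // (leq_trans t1) ?leq_addr.
exists (\max_j tau j) => t; apply/setP => j; rewrite inE.
case: (boolP (j \in F)) => jF; last by rewrite live.
have [t1 jt] := tauP j jF; apply/negbTE; apply: contra jt; apply/fintype.subsetP.
have le : (tau j <= (\max_j tau j + t).+1)%N.
  by rewrite leqW // (leq_trans (leq_bigmax j)) ?leq_addr.
by rewrite -(subnKC le); exact: sub.
Qed.

End Network.

(** * Reduction of an execution to averaging with fixed weights *)

Theorem theorem7 (R : realType) (n f : nat) (E : rel 'I_n) (F : {set 'I_n})
    (X : set R) (L : R) (h dh : 'I_n -> R -> R) (lam : nat -> R)
    (alive : nat -> {set 'I_n}) (rcv : nat -> 'I_n -> {set 'I_n})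
    (x : 'I_n -> nat -> R)
    (E_irrefl : irreflexive E)
    (F_le_f : (#|F| <= f)%N)
    (f_lt_n : (f < n)%N)
    (X_neq0 : X !=set0)
    (X_closed : closed X)
    (X_convex : convex_set (M := R^o) X)
    (h_admissible : forall i, admissible X L (h i) (dh i))
    (lam_stepsizes : stepsizes lam)
    (alive_crash : crash_pattern F alive)
    (x_execution : execution X E dh lam alive rcv x)
    (source : forall F' : {set 'I_n}, F' \subset F ->
       exists i, i \in source_component E F') :
  (forall i j, i \in ~: F -> j \in ~: F ->
     `|x i t - x j t| @[t --> \oo] --> (0 : R)) /\
  (forall i, i \in ~: F ->
     Dist (x i t) (valid_optima X (~: F) h (beta_tilde R E F) (gamma_tilde E F))
       @[t --> \oo] --> 0%E).
Proof.
have [live [T aliveT]] := crash_pattern_stable alive_crash.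
have [r] := source F (fintype.subxx _); rewrite inE => /andP[rF /forallP r_root].
have n0 : (0 < n)%N := leq_ltn_trans (leq0n f) f_lt_n.
pose A := closed_live_nbrs E F.
have jA j : j \in A j by exact: finset.setU11.
have A0 j : 0 < #|A j|%:R :> R by rewrite ltr0n; apply/card_gt0P; exists j.
have A_live j i : j \notin F -> i \in A j -> i \notin F.
  by move=> jF /(fintype.subsetP (closed_live_nbrs_sub E jF)); rewrite inE.
have h_grad i y z : X y -> X z -> h i y + dh i y * (z - y) <= h i z.
  apply: convex_gradient => //; first exact: admissible_convex (h_admissible i).
  exact: admissible_derivative (h_admissible i).
have dh_bound i y : X y -> `|dh i y| <= L.
  exact: admissible_bound (h_admissible i) y.
have dh_lip i y z : X y -> X z -> `|dh i y - dh i z| <= L * `|y - z|.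
  move=> Xy Xz.
  exact: (admissible_lipschitz (h_admissible i) (x := (y, z)) (conj Xy Xz)).
have h_argmin i : argmin X (h i) !=set0 := admissible_argmin_neq0 (h_admissible i).
have x_in j t : j \notin F -> X (x j t).
  move=> jF; case: t => [|t]; first exact: execution_init x_execution j.
  rewrite (execution_update x_execution) ?live //; exact: project_in.
(* From T on the live agents average with fixed weights.  A crashed agent is
   replaced by a fictitious one that copies the step of the root r, so that the
   weights are defined and stochastic on all of 'I_n. *)
pose W j i : R := if j \in F then (i == r)%:R else (i \in A j)%:R / #|A j|%:R.
pose g i t := x i (T + t)%N - lam (T + t)%N * dh i (x i (T + t)%N).
pose xs j t := if j \notin F then x j (T + t)%N else
  if t is s.+1 then project X (g r s) else x r T.
have W_ge0 j i : 0 <= W j i.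
  by rewrite /W; case: ifP => // _; rewrite divr_ge0 // ltW.
have W_mean j (y : 'I_n -> R) : \sum_i W j i * y i =
    if j \in F then y r else #|A j|%:R^-1 * \sum_(i in A j) y i.
  rewrite /W; case: ifP => jF.
    rewrite (bigD1 r) //= eqxx mul1r big1 ?addr0 // => i /negbTE ->.
    by rewrite mul0r.
  rewrite mulr_sumr [RHS]big_mkcond; apply: eq_bigr => i _.
  by case: (i \in A j); rewrite ?mul1r // !mul0r.
have W_sum j : \sum_i W j i = 1.
  have := W_mean j (fun=> 1); under eq_bigr do rewrite mulr1.
  by move=> ->; case: ifP => // _; rewrite sumr_const mulVf // lt0r_neq0.
have W_live j i : j \notin F -> i \in A j -> 0 < W j i.
  by move=> jF iA; rewrite /W (negbTE jF) iA divr_gt0.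
have W_rr : 0 < W r r by exact: W_live.
have W_root j : connect (fun i j => 0 < W j i) r j.
  case: (boolP (j \in F)) => jF; last first.
    have := r_root j; rewrite jF /=; apply: connect_sub => i k /and3P[iF kF Eik].
    by apply: connect1; apply: W_live => //; rewrite !inE Eik iF orbT.
  by apply: connect1; rewrite /W jF eqxx.
(* No agent, real or fictitious, gives weight to a member of [F], so the stationary distribution
   vanishes on [F]. *)
have W_dead i j : i \in F -> W j i = 0.
  move=> iF; rewrite /W; case: ifPn => jF.
    by case: eqP => // ir; rewrite -ir iF in rF.
  case: (boolP (i \in A j)) => [/(A_live _ _ jF)|_]; last by rewrite mul0r.
  by rewrite iF.
have [pi [pi_ge0 pi_sum pi_stat]] := stationary_distribution W_ge0 W_sum n0.
have pi_dead i : i \notin ~: F -> pi i = 0.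
  rewrite inE negbK => iF; rewrite -pi_stat big1 // => j _.
  by rewrite W_dead // mulr0.
have gamma_gt0 := gamma_tilde_gt0 E F n0.
have gamma_le j : (gamma_tilde E F <= #|A j|)%N.
  by rewrite /A -live_degE // gamma_tilde_le.
(* By stationarity [pi i] is a [pi]-average of the entries [W j i], and only live rows count, whose
   entries are at most [1 / #|A j|]. *)
have pi_le i : pi i <= (gamma_tilde E F)%:R^-1.
  have -> : (gamma_tilde E F)%:R^-1 = \sum_j pi j * (gamma_tilde E F)%:R^-1 :> R.
    by rewrite -mulr_suml pi_sum mul1r.
  rewrite -pi_stat; apply: ler_sum => j _.
  case: (boolP (j \in F)) => jF; first by rewrite pi_dead ?mul0r // inE jF.
  rewrite ler_wpM2l // /W (negbTE jF).
  apply: (@le_trans _ _ #|A j|%:R^-1).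
    by case: (i \in A j); rewrite ?mul1r // mul0r invr_ge0 ltW.
  by rewrite lef_pV2 ?posrE ?ltr0n ?ler_nat // (leq_trans gamma_gt0).
have xs_in j t : X (xs j t).
  rewrite /xs; case: ifPn => [jF|_]; first exact: x_in.
  by case: t => [|t]; [exact: x_in|exact: project_in].
have xs_step j t : xs j t.+1 =
    project X (\sum_i W j i * (xs i t - lam (T + t)%N * dh i (xs i t))).
  rewrite W_mean /xs; case: (boolP (j \in F)) => jF /=; first by rewrite rF.
  have aliveT2 : alive (T + t).+2 = ~: F by rewrite -addnS.
  rewrite addnS (execution_update x_execution) ?aliveT2 ?inE //.
  (* No crash occurs in this iteration, so the lower and upper bounds on the received set
     coincide. *)
  have rcvE : rcv (T + t).+1 j = in_nbrs E j :&: ~: F.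
    have := @execution_rcv _ _ _ _ _ _ _ _ _ x_execution (T + t)%N j.
    rewrite aliveT aliveT2 inE jF => /(_ isT) /andP[s1 s2].
    by apply/eqP; rewrite finset.eqEsubset s1 s2.
  rewrite rcvE finset.setUC -/(A j); congr (project X (_ * _)).
    by rewrite addn1 /A cardsU1 !inE E_irrefl.
  by apply: eq_bigr => i /(A_live _ _ jF) ->.
have [C lam_sqr] := stepsizes_tail_sum_sqr lam_stepsizes T.
have lam_noninc t : lam (T + t.+1)%N <= lam (T + t)%N.
  by rewrite addnS; exact: stepsizes_noninc.
have [a amin xs_cvg] := @states_cvg_argmin _ X L n h dh W pi r
  (fun t => lam (T + t)%N) xs C X_neq0 X_closed X_convex h_grad dh_bound h_argmin
  W_ge0 W_sum W_rr W_root pi_ge0 pi_sum pi_stat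
  (fun t => stepsizes_gt0 lam_stepsizes (T + t)%N)
  lam_noninc
  (stepsizes_tail_sum lam_stepsizes T) lam_sqr xs_in xs_step.
have x_cvg i : i \in ~: F -> x i t @[t --> \oo] --> a.
  rewrite inE => iF; rewrite -(cvg_shiftn T).
  rewrite (_ : [sequence x i (t + T)%N]_t = xs i); first exact: xs_cvg.
  by apply/funext => t; rewrite /xs iF addnC.
(* The weights are exchanged only after the limit [a] is known: [alpha] matches the slope of the
   [pi]-mixture at that single point. *)
have [alpha [alpha_ge0 alpha_sum alpha_card alphaE]] :=
  valid_weights (fun i => dh i a) gamma_gt0
    (leq_trans (gamma_le r) (subset_leq_card (closed_live_nbrs_sub E rF)))
    pi_ge0 pi_dead pi_sum pi_le.
have a_opt : valid_optima X (~: F) h (beta_tilde R E F) (gamma_tilde E F) a.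
  exists (fun y => \sum_i alpha i * h i y); last first.
    exact: (argmin_same_slope X_convex h_grad dh_lip pi_ge0 pi_sum).
  exists alpha; split => //; apply: leq_trans alpha_card _.
  apply: subset_leq_card; apply/fintype.subsetP => i; rewrite !inE => /andP[-> /=].
  by apply: le_trans; rewrite ge_min lexx orbT.
split=> [i j iF jF|i iF].
  rewrite -[X in _ --> X](normr0 R) -(subrr a).
  by apply: cvg_norm; apply: cvgB; exact: x_cvg.
apply: (@squeeze_cvge _ _ _ _ (fun=> 0%E) _ (fun t => (`|x i t - a|)%:E)).
(* Since [a] is itself a valid optimum, the distance is squeezed between 0 and [|x i t - a|]. *)
- apply: nearW => t; apply/andP; split.
    by apply/ereal_infP => _ [y _ <-]; rewrite lee_fin.
  by apply: ereal_inf_lbound; exists a.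
- exact: cvg_cst.
- apply/fine_cvgP; split; first by apply: nearW.
  rewrite -(normr0 R) -(subrr a).
  by apply: cvg_norm; apply: cvgB; [exact: x_cvg|exact: cvg_cst].
Qed.
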